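(* Let $\mathbb{S}$ be a finite set, $n\ge1$, and let $\pi$ be a probability measure on $\mathbb{S}^n$ whose support $\mathcal{X}:=\{x\in\mathbb{S}^n\colon\pi(x)>0\}$ has at least two elements and is connected under single-coordinate changes. Let $P$ be the transition matrix on $\mathcal{X}$ of the Glauber dynamics for $\pi$: $$P(x,y):=\frac1n\sum_{i\in[n]}\sum_{\sigma\in\mathbb{S}}\pi_i(\sigma|x)\mathbf{1}_{(y=x^{i,\sigma})}.$$ Suppose that $\pi$ satisfies the following weak dependency condition: $$\pi_i(y_i|x)\ge\sum_{j\neq i}\sum_{\sigma\neq x_j}\left(\pi_j(\sigma|y)-\pi_j(\sigma|x)\right)_+$$ for all $i\in[n]$ and all $x,y\in\mathcal{X}$ that differ exactly at the $i$-th coordinate. Then: (a) $P$ has non-negative sectional curvature with respect to the combinatorial distance $\mathrm{d}(x,y):=\min\{k\in\{0,1,2,\ldots\}\colon P^k(x,y)>0\}$ on $\mathcal{X}$; (b) $P$ satisfies the entropic contraction $H(\mu P\,|\,\pi)\le(1-\kappa)H(\mu\,|\,\pi)$ for all $\mu\in\mathcal{P}(\mathcal{X})$, with constant $$\kappa:=\frac1n\min_{i,x,y}\left\{1-\sum_{j\neq i}\sum_{\sigma\neq x_j}\left|\pi_j(\sigma|y)-\pi_j(\sigma|x)\right|\right\}\ge0,$$ where the minimum ranges over all $i\in[n]$ and all $x,y\in\mathcal{X}$ that differ exactly at $i$.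
   Context: $[n]=\{1,\ldots,n\}$; $x^{i,\sigma}:=(x_1,\ldots,x_{i-1},\sigma,x_{i+1},\ldots,x_n)$; $a_+=\max(a,0)$; $j$ ranges over $[n]$ and $\sigma$ over $\mathbb{S}$ in the sums. For $x\in\mathcal{X}$ and $i\in[n]$, the conditional law of the $i$-th coordinate is $\pi_i(\sigma|x):=\pi(x^{i,\sigma})/\sum_{\sigma'\in\mathbb{S}}\pi(x^{i,\sigma'})$. ''Connected under single-coordinate changes'' means that any two elements of $\mathcal{X}$ are joined by a sequence of elements of $\mathcal{X}$ in which consecutive elements differ in exactly one coordinate; then $P$ is irreducible and reversible with respect to $\pi$. Non-negative sectional curvature of a stochastic matrix $P$ with invariant law $\pi$ with respect to a metric $\mathrm{d}$ means: for each $(x,y)\in\mathcal{X}^2$ there is a coupling $(X^\star,Y^\star)$ of $P^\star(x,\cdot)$ and $P^\star(y,\cdot)$ with $\mathrm{d}(X^\star,Y^\star)\le\mathrm{d}(x,y)$ almost surely, where $P^\star$ is the adjoint of $P$ in $L^2(\mathcal{X},\pi)$ (here $P^\star=P$). $\mathcal{P}(\mathcal{X})$ is the set of probability measures on $\mathcal{X}$, and $H(\mu\,|\,\pi):=\sum_x\mu(x)\log(\mu(x)/\pi(x))$ is the relative entropy (with $0\log0=0$). *)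

(* Defs.v *)
(* Finite state spaces are finTypes, laws on them are mass functions T -> R and
   transition matrices are functions T -> T -> R, over an arbitrary realType R. *)
From HB Require Import structures.
From mathcomp Require Import all_boot all_order all_algebra.
From mathcomp Require Import all_classical all_reals all_analysis.

Set Implicit Arguments.
Unset Strict Implicit.
Unset Printing Implicit Defensive.

Import Order.TTheory GRing.Theory Num.Theory.
Local Open Scope ring_scope.

Section FiniteMarkov.
Context {R : realType} {T : finType}.
Implicit Types (mu nu pi f g : T -> R) (P Q : T -> T -> R).

Definition is_law mu : Prop := (forall x, 0 <= mu x) /\ \sum_x mu x = 1.

Definition law_step mu P : T -> R := fun y => \sum_x mu x * P x y.

Definition apply_kernel P f : T -> R := fun x => \sum_y P x y * f y.

Fixpoint kernel_pow P (k : nat) : T -> T -> R :=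
  if k is k'.+1 then fun x y => \sum_z P x z * kernel_pow P k' z y
  else fun x y => (x == y)%:R.

(* The value 0 is a default, used only when y is not reachable from x; this
   never happens when P is irreducible. *)
Definition comb_dist P (x y : T) : nat :=
  if pselect (exists k, 0 < kernel_pow P k x y) is left h then ex_minn h else 0%N.

Definition dotL2 pi f g : R := \sum_x pi x * (f x * g x).

Definition is_adjoint pi P Q : Prop :=
  forall f g, dotL2 pi (apply_kernel P f) g = dotL2 pi f (apply_kernel Q g).

(* C x y is the joint mass P(X = x, Y = y). *)
Definition is_coupling mu nu (C : T -> T -> R) : Prop :=
  [/\ forall x y, 0 <= C x y,
      \sum_x \sum_y C x y = 1,
      forall x, \sum_y C x y = mu x &
      forall y, \sum_x C x y = nu y].

(* When pi > 0 everywhere, the adjoint kernel exists and is unique. *)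
Definition nonneg_sectional_curvature pi P (d : T -> T -> R) : Prop :=
  exists2 Pstar, is_adjoint pi P Pstar &
    forall x y, exists2 C, is_coupling (Pstar x) (Pstar y) C &
      forall u v, 0 < C u v -> d u v <= d x y.

(* ln 0 = 0 in the library, so a term with mu x = 0 contributes 0. *)
Definition rel_entropy mu pi : R := \sum_x mu x * ln (mu x / pi x).

End FiniteMarkov.

Section Glauber.
Context {R : realType} {S : finType} {n : nat}.
Local Notation config := {ffun 'I_n -> S}.
Implicit Types (pi : config -> R).

Definition upd (x : config) (i : 'I_n) (s : S) : config :=
  [ffun j => if j == i then s else x j].

Definition differ_at (i : 'I_n) (x y : config) : bool :=
  [set j | x j != y j] == [set i].

Definition differ_once (x y : config) : bool := #|[set j | x j != y j]| == 1%N.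

Record supp_space pi := SuppSpace { supp_val :> config; _ : 0 < pi supp_val }.
HB.instance Definition _ pi := [isSub for @supp_val pi].
HB.instance Definition _ pi := [Finite of supp_space pi by <:].

Definition pi_on_supp pi : supp_space pi -> R := fun x => pi x.

Definition single_site_connected pi : Prop :=
  forall x y : supp_space pi,
    connect (fun u v : supp_space pi => differ_once u v) x y.

Definition cond_law pi (i : 'I_n) (s : S) (x : config) : R :=
  pi (upd x i s) / \sum_(s' : S) pi (upd x i s').

Definition glauber pi : supp_space pi -> supp_space pi -> R :=
  fun x y => n%:R^-1 * \sum_(i < n) \sum_(s : S)
               cond_law pi i s x * ((y : config) == upd x i s)%:R.

Definition weak_dependency pi : Prop :=
  forall (i : 'I_n) (x y : supp_space pi), differ_at i x y ->
    \sum_(j < n | j != i) \sum_(s : S | s != x j)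
       Num.max (cond_law pi j s y - cond_law pi j s x) 0
    <= cond_law pi i (y i) x.

Definition dependency_slack pi (i : 'I_n) (x y : config) : R :=
  1 - \sum_(j < n | j != i) \sum_(s : S | s != x j)
         `|cond_law pi j s y - cond_law pi j s x|.

(* The minimum is taken in \bar R because the iterated minimum needs a neutral
   element; it is a real number as soon as the index family is nonempty. *)
Definition glauber_kappa pi : R :=
  n%:R^-1 * fine (\big[mine/+oo%E]_(i < n)
                  \big[mine/+oo%E]_(x : supp_space pi)
                  \big[mine/+oo%E]_(y : supp_space pi | differ_at i x y)
                    (dependency_slack pi i x y)%:E).

End Glauber.

(* Main.v *)
(* Let lam > 1 - kappa.  By duality, entropy contraction with factor lam amounts
   to deficit g := ln E[e^g] - lam ln E[e^(P g / lam)] >= 0 for every g.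
   Put T g := ln P e^(P g / lam).  Then deficit (T g) <= deficit g.  Couplings
   of neighbouring rows which never move to distance more than 1 make
   g |-> ln P e^g preserve Lipschitz constants, and P itself contracts them by
   1 - kappa, so T contracts them by (1 - kappa) / lam < 1.  Hence T^k g becomes
   constant up to a vanishing error, on constants the deficit vanishes, and so
   deficit g >= lim deficit (T^k g) = 0.
   For the Glauber dynamics, one explicit coupling of neighbouring rows gives
   both the distance bound and the contraction rate kappa. *)
Require Import Defs.
From mathcomp Require Import all_boot all_order all_algebra.
From mathcomp Require Import all_classical all_reals all_analysis.
From mathcomp Require Import ring lra.

Set Implicit Arguments.
Unset Strict Implicit.
Unset Printing Implicit Defensive.

Import Order.TTheory GRing.Theory Num.Theory.
Local Open Scope ring_scope.

(** * Couplings of laws on a finite set *)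

Section Couplings.
Context {R : realType} {T : finType}.
Implicit Types (mu nu rho f g : T -> R) (C : T -> T -> R).

Lemma psumr_gt0 (I : finType) (F : I -> R) :
  0 < \sum_i F i -> exists i, 0 < F i.
Proof.
move=> F_gt0; apply: contrapT => /forallNP F_le0; move: F_gt0.
by rewrite ltNge sumr_le0 // => i _; rewrite leNgt; apply/negP/F_le0.
Qed.

Lemma coupling_suml mu nu C f : is_coupling mu nu C ->
  \sum_u \sum_v C u v * f u = \sum_u mu u * f u.
Proof. by case=> _ _ Cl _; apply: eq_bigr => u _; rewrite -mulr_suml Cl. Qed.

Lemma coupling_sumr mu nu C f : is_coupling mu nu C ->
  \sum_u \sum_v C u v * f v = \sum_v nu v * f v.
Proof.
case=> _ _ _ Cr; rewrite exchange_big /=.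
by apply: eq_bigr => v _; rewrite -mulr_suml Cr.
Qed.

Lemma coupling_diag mu : is_law mu ->
  is_coupling mu mu (fun u v => mu u * (u == v)%:R).
Proof.
move=> [mu0 mu1].
have dl u : \sum_v mu u * (u == v)%:R = mu u.
  rewrite (bigD1 u) //= eqxx mulr1 big1 ?addr0 // => v.
  by rewrite eq_sym => /negPf ->; rewrite mulr0.
split=> [x y|||y] //; first by rewrite mulr_ge0.
  by rewrite (eq_bigr mu).
rewrite (bigD1 y) //= eqxx mulr1 big1 ?addr0 // => v /negPf ->.
by rewrite mulr0.
Qed.

(** The endpoints are made conditionally independent given the middle point [w]. Where [nu w = 0]
    the division returns 0, which is harmless: [C1 u w] and [C2 w v] vanish there too. *)
Lemma coupling_glue mu nu rho C1 C2 :
  is_coupling mu nu C1 -> is_coupling nu rho C2 ->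
  exists2 C, is_coupling mu rho C &
    forall u v, 0 < C u v -> exists2 w, 0 < C1 u w & 0 < C2 w v.
Proof.
move=> [C1ge0 C1sum C1l C1r] [C2ge0 C2sum C2l C2r].
have nu_ge0 w : 0 <= nu w by rewrite -C2l sumr_ge0.
have C1nu u w : C1 u w / nu w * nu w = C1 u w.
  have [nu0|nuN0] := eqVneq (nu w) 0; last by rewrite divfK.
  rewrite nu0 mulr0; apply/esym/eqP; rewrite eq_le C1ge0 andbT -nu0 -C1r.
  by rewrite (bigD1 u) //= lerDl sumr_ge0.
have C2nu w v : nu w * (C2 w v / nu w) = C2 w v.
  have [nu0|nuN0] := eqVneq (nu w) 0; last by rewrite mulrC divfK.
  rewrite nu0 mul0r; apply/esym/eqP; rewrite eq_le C2ge0 andbT -nu0 -C2l.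
  by rewrite (bigD1 v) //= lerDl sumr_ge0.
have Cl u : \sum_v \sum_w C1 u w / nu w * C2 w v = mu u.
  rewrite exchange_big /= -C1l; apply: eq_bigr => w _.
  by rewrite -mulr_sumr C2l C1nu.
exists (fun u v => \sum_w C1 u w / nu w * C2 w v) => [|u v /psumr_gt0 [w Cw]].
  split=> [u v|||v] //.
  - by apply: sumr_ge0 => w _; rewrite mulr_ge0 ?divr_ge0.
  - rewrite (eq_bigr mu) // -C1sum; apply: eq_bigr => u _.
    by rewrite C1l.
  - rewrite exchange_big /= -C2r; apply: eq_bigr => w _.
    rewrite (eq_bigr (fun u => C1 u w * (C2 w v / nu w))).
      by rewrite -mulr_suml C1r C2nu.
    by move=> u _; rewrite mulrAC mulrA.
exists w; rewrite lt_def ?C1ge0 ?C2ge0 andbT; apply: contraTneq Cw => ->.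
  by rewrite !mul0r ltxx.
by rewrite mulr0 ltxx.
Qed.

End Couplings.

(** * Reachability and the combinatorial distance *)

Lemma kernel_pow_ge0 (R : realType) (T : finType) (P : T -> T -> R) :
  (forall x y, 0 <= P x y) -> forall k x y, 0 <= kernel_pow P k x y.
Proof.
move=> P_ge0; elim=> [|k IHk] x y //=.
by apply: sumr_ge0 => z _; rewrite mulr_ge0.
Qed.

Lemma kernel_pow_connect (R : realType) (T : finType) (P : T -> T -> R)
    (e : rel T) (x y : T) :
  (forall u v, 0 <= P u v) -> (forall u v, e u v -> 0 < P u v) ->
  connect e x y -> exists k, 0 < kernel_pow P k x y.
Proof.
move=> P_ge0 eP /connectP [p xp ->].
have pow_ge0 := kernel_pow_ge0 P_ge0.
elim: p x xp => [|z p IHp] x /=; first by exists 0%N; rewrite /= eqxx.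
case/andP => /eP xz /IHp [k zk]; exists k.+1 => /=.
rewrite (bigD1 z) //= ltr_pwDl ?mulr_gt0 // sumr_ge0 // => t _.
by rewrite mulr_ge0.
Qed.

Lemma comb_dist_gt0 (R : realType) (T : finType) (P : T -> T -> R) (x y : T) :
  (exists k, 0 < kernel_pow P k x y) -> 0 < kernel_pow P (comb_dist P x y) x y.
Proof. by rewrite /comb_dist; case: pselect => // h _; case: ex_minnP. Qed.

Lemma comb_dist_le (R : realType) (T : finType) (P : T -> T -> R) (x y : T) k :
  0 < kernel_pow P k x y -> (comb_dist P x y <= k)%N.
Proof.
rewrite /comb_dist; case: pselect => // h xy.
by case: ex_minnP => m _; apply.
Qed.

(** * Stochastic kernels: duality, reversibility, couplings along trajectories *)

Section Kernels.
Context {R : realType} {T : finType}.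
Variables (pi : T -> R) (P : T -> T -> R).
Hypothesis P_law : forall x, is_law (P x).
Implicit Types (mu f g : T -> R).

Lemma apply_kernel_le c g x :
  (forall y, g y <= c) -> apply_kernel P g x <= c.
Proof.
move=> gc; have [P0 P1] := P_law x.
rewrite -[leRHS]mul1r -P1 mulr_suml; apply: ler_sum => y _.
exact: ler_wpM2l.
Qed.

Lemma apply_kernel_expR_gt0 g x : 0 < apply_kernel P (fun y => expR (g y)) x.
Proof.
have [P0 P1] := P_law x.
have [y Py] : exists y, 0 < P x y by apply: psumr_gt0; rewrite P1.
rewrite /apply_kernel (bigD1 y) //= ltr_pwDl ?mulr_gt0 ?expR_gt0 //.
by apply: sumr_ge0 => z _; rewrite mulr_ge0 ?expR_ge0.
Qed.

Lemma law_step_dual mu g :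
  \sum_y law_step mu P y * g y = \sum_x mu x * apply_kernel P g x.
Proof.
under eq_bigr do rewrite /law_step mulr_suml.
rewrite exchange_big /=; apply: eq_bigr => x _.
by rewrite /apply_kernel mulr_sumr; apply: eq_bigr => y _; rewrite mulrA.
Qed.

Lemma law_step_law mu : is_law mu -> is_law (law_step mu P).
Proof.
move=> [mu0 mu1]; split=> [y|].
  by apply: sumr_ge0 => x _; have [P0 _] := P_law x; rewrite mulr_ge0.
rewrite /law_step exchange_big /= -mu1; apply: eq_bigr => x _.
by have [_ P1] := P_law x; rewrite -mulr_sumr P1 mulr1.
Qed.

Hypothesis P_rev : forall x y, pi x * P x y = pi y * P y x.

(** By reversibility, [P] acts on densities with respect to [pi] as it acts on functions. *)
Lemma law_step_density f y :
  law_step (fun x => pi x * f x) P y = pi y * apply_kernel P f y.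
Proof.
rewrite /law_step /apply_kernel mulr_sumr; apply: eq_bigr => x _.
by rewrite mulrAC P_rev -mulrA.
Qed.

Lemma reversible_adjoint : is_adjoint pi P P.
Proof.
move=> f g; rewrite /dotL2.
under eq_bigr do rewrite mulrCA mulrC -mulrA.
under [RHS]eq_bigr do rewrite mulrA.
rewrite -[RHS]law_step_dual; apply: eq_bigr => y _.
by rewrite law_step_density mulrAC mulrA.
Qed.

(* Couplings of adjacent rows are glued along a trajectory of length k from
   x to y, so that no property of the graph distance itself is needed. *)
Lemma kernel_pow_coupling :
  (forall x y, 0 < P x y -> exists2 C, is_coupling (P x) (P y) C &
     forall u v, 0 < C u v -> 0 < P u v) ->
  forall k x y, 0 < kernel_pow P k x y ->
  exists2 C, is_coupling (P x) (P y) C &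
    forall u v, 0 < C u v -> 0 < kernel_pow P k u v.
Proof.
move=> P_cpl.
have pow_ge0 := kernel_pow_ge0 (fun u => (P_law u).1).
elim=> [|k IHk] x y /=.
  have [<- _|_] := eqVneq x y; last by rewrite ltxx.
  exists (fun u v => P x u * (u == v)%:R); first exact: coupling_diag.
  by move=> u v; have [|_] := eqVneq u v; rewrite ?mulr0 ?ltxx.
have [P0 _] := P_law x.
move=> /psumr_gt0 [z xzy].
have xz : 0 < P x z.
  by rewrite lt_def P0 andbT; apply: contraTneq xzy => ->; rewrite mul0r ltxx.
have zy : 0 < kernel_pow P k z y by rewrite -(pmulr_rgt0 _ xz).
have [C1 C1c C1p] := P_cpl _ _ xz; have [C2 C2c C2p] := IHk _ _ zy.
have [C Cc Cp] := coupling_glue C1c C2c.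
exists C => // u v /Cp [w /C1p uw /C2p wv].
rewrite (bigD1 w) //= ltr_pwDl ?mulr_gt0 //.
by apply: sumr_ge0 => t _; have [Pu0 _] := P_law u; rewrite mulr_ge0.
Qed.

End Kernels.

(** * Entropy contraction from couplings of neighbouring rows *)

Section EntropyContraction.
Context {R : realType} {T : finType}.
Variables (pi : T -> R) (P : T -> T -> R) (e : rel T) (kappa : R).
Hypothesis pi_gt0 : forall x, 0 < pi x.
Hypothesis pi_law : is_law pi.
Hypothesis P_law : forall x, is_law (P x).
Hypothesis P_rev : forall x y, pi x * P x y = pi y * P y x.
Hypothesis e_conn : forall x y, connect e x y.
Hypothesis kappa_le1 : kappa <= 1.
Hypothesis e_cpl : forall x y, e x y ->
  exists2 C, is_coupling (P x) (P y) C &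
    (forall u v, 0 < C u v -> u = v \/ e u v) /\ kappa <= \sum_u C u u.
Implicit Types (mu f g h : T -> R) (L : R).

Definition edge_lipschitz g L := forall x y, e x y -> g x - g y <= L.

(** A shortened path visits distinct points, so [#|T|] bounds its length. This crude diameter bound
    suffices because [L] will tend to 0. *)
Lemma edge_lipschitz_osc g L x y :
  0 <= L -> edge_lipschitz g L -> g x - g y <= #|T|%:R * L.
Proof.
move=> L0 gL; have /connectP [p /shortenP [q qp uq _] ->] := e_conn x y.
apply: (@le_trans _ _ ((size q)%:R * L)); last first.
  rewrite ler_wpM2r // ler_nat.
  by apply: ltnW; have /card_uniqP /= <- := uq; apply: max_card.
elim: q x qp {uq} => [|z q IHq] x /=; first by rewrite subrr mul0r.
move=> /andP [xz /IHq zq]; rewrite -natr1 mulrDl mul1r.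
by have := gL _ _ xz; lra.
Qed.

(** The difference is the mean of [g u - g v] under the coupling: the diagonal contributes 0, and
    the remaining mass, at most [1 - kappa], sits on edges. *)
Lemma apply_kernel_lipschitz g L : 0 <= L ->
  edge_lipschitz g L -> edge_lipschitz (apply_kernel P g) ((1 - kappa) * L).
Proof.
move=> L0 gL x y xy; have [C Cc [Ce Ck]] := e_cpl xy.
have [C0 C1 _ _] := Cc.
rewrite /apply_kernel -(coupling_suml _ Cc) -(coupling_sumr _ Cc) -sumrB.
have -> : 1 - kappa = \sum_u \sum_v C u v - kappa by rewrite C1.
apply: (@le_trans _ _ ((\sum_u \sum_v C u v - \sum_u C u u) * L)); last first.
  by rewrite ler_wpM2r // lerD2l lerN2.
rewrite -sumrB mulr_suml; apply: ler_sum => u _.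
have -> : \sum_v C u v - C u u = \sum_(v | v != u) C u v.
  by rewrite (bigD1 u) //= addrAC subrr add0r.
rewrite -sumrB (bigD1 u) //= subrr add0r mulr_suml.
apply: ler_sum => v vu; rewrite -mulrBr.
have [Cuv|] := ltP 0 (C u v).
  rewrite ler_wpM2l //; case: (Ce _ _ Cuv) => [uv|]; last exact: gL.
  by rewrite uv eqxx in vu.
move=> Cle0; have -> : C u v = 0 by apply/le_anti; rewrite Cle0 C0.
by rewrite !mul0r.
Qed.

(** Coupled pairs satisfy [expR (g u) <= expR L * expR (g v)]; averaging keeps the factor
    [expR L]. *)
Lemma ln_apply_kernel_expR_lipschitz g L : 0 <= L -> edge_lipschitz g L ->
  edge_lipschitz (fun x => ln (apply_kernel P (fun y => expR (g y)) x)) L.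
Proof.
move=> L0 gL x y xy; have [C Cc [Ce _]] := e_cpl xy; have [C0 _ _ _] := Cc.
have E0 := apply_kernel_expR_gt0 P_law g.
rewrite lerBlDr -[L]expRK -lnM ?posrE ?expR_gt0 // ler_ln ?posrE ?mulr_gt0 //.
  rewrite {1 2}/apply_kernel -(coupling_suml _ Cc) -(coupling_sumr _ Cc).
  rewrite mulr_sumr; apply: ler_sum => u _; rewrite mulr_sumr.
  apply: ler_sum => v _; rewrite mulrCA.
  have [Cuv|] := ltP 0 (C u v); last first.
    move=> Cle0; have -> : C u v = 0 by apply/le_anti; rewrite Cle0 C0.
    by rewrite !mul0r.
  rewrite ler_wpM2l // -expRD ler_expR.
  case: (Ce _ _ Cuv) => [->|/gL]; lra.
exact: expR_gt0.
Qed.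

Definition log_mgf g : R := ln (\sum_x pi x * expR (g x)).

Lemma mgf_gt0 g : 0 < \sum_x pi x * expR (g x).
Proof.
have [_ pi1] := pi_law.
have [x _] : exists x, 0 < pi x by apply: psumr_gt0; rewrite pi1.
rewrite (bigD1 x) //= ltr_pwDl ?mulr_gt0 ?expR_gt0 //.
by apply: sumr_ge0 => z _; rewrite mulr_ge0 ?expR_ge0 // ltW.
Qed.

Lemma log_mgf_le g c : (forall x, g x <= c) -> log_mgf g <= c.
Proof.
move=> gc; rewrite /log_mgf -[leRHS]expRK ler_ln ?posrE ?expR_gt0 ?mgf_gt0 //.
have [_ pi1] := pi_law; rewrite -[leRHS]mul1r -pi1 mulr_suml.
by apply: ler_sum => x _; rewrite ler_wpM2l ?ler_expR // ltW.
Qed.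

Lemma log_mgf_ge g c : (forall x, c <= g x) -> c <= log_mgf g.
Proof.
move=> gc; rewrite /log_mgf -[leLHS]expRK ler_ln ?posrE ?expR_gt0 ?mgf_gt0 //.
have [_ pi1] := pi_law; rewrite -[leLHS]mul1r -pi1 mulr_suml.
by apply: ler_sum => x _; rewrite ler_wpM2l ?ler_expR // ltW.
Qed.

(** This is [ln t <= t - 1] applied pointwise to the ratio of the Gibbs law, proportional to
    [pi x * expR (g x)], to [mu]. *)
Lemma gibbs_variational mu g : is_law mu ->
  \sum_x mu x * g x <= rel_entropy mu pi + log_mgf g.
Proof.
move=> [mu0 mu1]; have Z0 := mgf_gt0 g.
set Z := \sum_x _ in Z0.
have -> : log_mgf g = \sum_x mu x * ln Z by rewrite -mulr_suml mu1 mul1r.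
rewrite -subr_le0 -big_split /= -sumrB.
(* The middle term is a difference of two total masses equal to 1. *)
apply: (@le_trans _ _ (\sum_x (pi x * expR (g x) / Z - mu x))); last first.
  by rewrite sumrB -mulr_suml mu1 mulfV ?subrr ?gt_eqF.
apply: ler_sum => x _.
have [mux|muxN] := eqVneq (mu x) 0.
  by rewrite mux !mul0r addr0 !subr0 divr_ge0 ?mulr_ge0 ?expR_ge0 // ltW.
have mu_gt0 : 0 < mu x by rewrite lt_def muxN mu0.
have q0 : 0 < pi x * expR (g x) / Z / mu x.
  by rewrite !divr_gt0 ?mulr_gt0 ?expR_gt0.
have : ln (pi x * expR (g x) / Z / mu x) <= pi x * expR (g x) / Z / mu x - 1.
  have := @le_ln1Dx R (pi x * expR (g x) / Z / mu x - 1).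
  by rewrite [1 + _]addrC subrK; apply; rewrite ltrBrDl subrr.
rewrite !ln_div ?posrE ?divr_gt0 ?mulr_gt0 ?expR_gt0 //.
rewrite lnM ?posrE ?expR_gt0 // expRK => ineq.
apply: (@le_trans _ _ (mu x * (pi x * expR (g x) / Z / mu x - 1))).
  by apply: le_trans (ler_wpM2l (mu0 x) ineq); lra.
by rewrite mulrBr mulr1 mulrC divfK.
Qed.

Section Rate.
Variable lam : R.
Hypothesis lam_gt : 1 - kappa < lam.

Let lam_gt0 : 0 < lam.
Proof. by apply: le_lt_trans lam_gt; rewrite subr_ge0. Qed.

Let tilt g := fun x => lam^-1 * apply_kernel P g x.

(** The map T of the proof idea: the inner kernel contracts Lipschitz constants, the outer logarithm
    preserves them. *)
Let smooth g := fun x => ln (apply_kernel P (fun y => expR (tilt g y)) x).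

Let deficit g := log_mgf g - lam * log_mgf (tilt g).

(* Both sides are compared through Gibbs' variational principle at the tilted
   law w, with density exp(tilt g) / Z, whose image under P has density
   exp(smooth g) / Z. *)
Lemma deficit_smooth g : deficit (smooth g) <= deficit g.
Proof.
set Z := \sum_x pi x * expR (tilt g x).
have Z0 : 0 < Z := mgf_gt0 _.
pose w x := pi x * (expR (tilt g x) / Z).
have w_law : is_law w.
  split=> [x|]; first by rewrite mulr_ge0 ?divr_ge0 ?expR_ge0 // ltW.
  by under eq_bigr do rewrite /w mulrA; rewrite -mulr_suml mulfV ?gt_eqF.
have wP y : law_step w P y = pi y * (expR (smooth g y) / Z).
  rewrite /w law_step_density // lnK ?posrE ?apply_kernel_expR_gt0 //.
  rewrite /apply_kernel mulr_suml; congr (_ * _).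
  by apply: eq_bigr => z _; rewrite mulrA.
have wP_law := law_step_law P_law w_law.
have ent v h : is_law v -> (forall x, v x = pi x * (expR (h x) / Z)) ->
    rel_entropy v pi = \sum_x v x * h x - ln Z.
  move=> [_ v1] vE; rewrite -[ln Z]mul1r -v1 mulr_suml -sumrB.
  apply: eq_bigr => x _; rewrite -mulrBr {2}vE mulrAC mulfV ?gt_eqF // mul1r.
  by rewrite ln_div ?posrE ?expR_gt0 // expRK.
have lZ : log_mgf (smooth g) = ln Z.
  have [_] := wP_law; under eq_bigr do rewrite wP mulrA.
  by rewrite -mulr_suml /log_mgf => /divr1_eq ->.
(* The Gibbs inequality is used at [law_step w P] against [g] and at [w] against [tilt (smooth g)].
   Once the second is multiplied by [lam], the means of [P g] and [P (smooth g)] under [w] cancel in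
   the sum. *)
have := gibbs_variational g wP_law.
rewrite (ent _ _ wP_law wP) !law_step_dual => G1.
have := gibbs_variational (tilt (smooth g)) w_law.
rewrite (ent _ (tilt g) w_law (fun=> erefl)) => G2.
have tE h : \sum_x w x * tilt h x = lam^-1 * \sum_x w x * apply_kernel P h x.
  by rewrite mulr_sumr; apply: eq_bigr => x _; rewrite mulrCA.
move: G2; rewrite !tE -(ler_pM2l lam_gt0) !mulrDr mulrN.
rewrite !mulVKf ?gt_eqF // => G2.
rewrite /deficit lZ [log_mgf (tilt g)]/log_mgf -/Z.
lra.
Qed.

Lemma smooth_lipschitz g L : 0 <= L -> edge_lipschitz g L ->
  edge_lipschitz (smooth g) (lam^-1 * (1 - kappa) * L).
Proof.
move=> L0 gL; apply: ln_apply_kernel_expR_lipschitz.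
  by rewrite !mulr_ge0 ?invr_ge0 ?subr_ge0 // ltW.
move=> x y xy; rewrite -mulrBr -mulrA ler_wpM2l ?invr_ge0 ?(ltW lam_gt0) //.
exact: (apply_kernel_lipschitz L0 gL).
Qed.

(** The factor [lam] undoes the [lam^-1] in [tilt], so both terms of the deficit are compared with
    the same value [g x0], at a cost of [#|T|%:R * L] each. *)
Lemma deficit_lower_bound g L : 0 <= L -> edge_lipschitz g L ->
  - (2 * #|T|%:R * L) <= deficit g.
Proof.
move=> L0 gL; have [_ pi1] := pi_law.
have [x0 _] : exists x, 0 < pi x by apply: psumr_gt0; rewrite pi1.
have lo : g x0 - #|T|%:R * L <= log_mgf g.
  apply: log_mgf_ge => x; have := edge_lipschitz_osc x0 x L0 gL; lra.
have up : log_mgf (tilt g) <= lam^-1 * (g x0 + #|T|%:R * L).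
  apply: log_mgf_le => x; rewrite ler_pM2l ?invr_gt0 //.
  apply: apply_kernel_le => // y; have := edge_lipschitz_osc y x0 L0 gL; lra.
move: up; rewrite -(ler_pM2l lam_gt0) mulVKf ?gt_eqF // => up.
rewrite /deficit; lra.
Qed.

Lemma deficit_ge0 g : 0 <= deficit g.
Proof.
pose r := lam^-1 * (1 - kappa).
have r0 : 0 <= r by rewrite mulr_ge0 ?invr_ge0 ?subr_ge0 // ltW.
have r1 : r < 1 by rewrite /r mulrC ltr_pdivrMr // mul1r.
(* Any finite constant would do; this sum dominates every single difference. *)
pose L := \sum_x \sum_y `|g x - g y|.
have L0 : 0 <= L by apply: sumr_ge0 => x _; apply: sumr_ge0.
have gL : edge_lipschitz g L.
  move=> x y _; rewrite /L (bigD1 x) //= (bigD1 y) //=.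
  apply: (le_trans (ler_norm _)); rewrite -addrA lerDl addr_ge0 // sumr_ge0 //.
  by move=> z _; apply: sumr_ge0.
(* Passing from [h] to [smooth h] does not raise the deficit and multiplies the Lipschitz constant
   by [r]. *)
have iter_ge k h M : 0 <= M -> edge_lipschitz h M ->
    - (2 * #|T|%:R * (r ^+ k * M)) <= deficit h.
  elim: k h M => [|k IHk] h M M0 hM.
    by rewrite expr0 mul1r; apply: deficit_lower_bound.
  apply: le_trans (deficit_smooth h).
  rewrite exprSr -[_ * r * M]mulrA; apply: IHk; first by rewrite mulr_ge0.
  exact: smooth_lipschitz.
apply/ler_addgt0Pr => eps eps0.
have r_lt1 : `|r| < 1 by rewrite ger0_norm.
have [k /= small] :=
  filter_ex (cvgr_lt _ (cvg_geometric (2 * #|T|%:R * L) r_lt1) _ eps0).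
have := iter_ge k _ _ L0 gL; rewrite [r ^+ k * L]mulrC mulrA.
lra.
Qed.

(** Gibbs' principle at [mu] with [tilt G], then [deficit_ge0] at [G], for a [G] that almost attains
    the entropy of [nu]. *)
Lemma entropy_step_le mu : is_law mu ->
  rel_entropy (law_step mu P) pi <= lam * rel_entropy mu pi.
Proof.
move=> mu_law; set nu := law_step mu P.
have [nu0 nu1] : is_law nu := law_step_law P_law mu_law.
have [_ pi1] := pi_law.
apply/ler_addgt0Pr => del del0.
(* The optimal test function is the log-density; adding [del] keeps the argument positive where [nu]
   vanishes and makes [log_mgf G] at most [del]. *)
pose G x := ln (nu x / pi x + del).
have q0 x : 0 < nu x / pi x + del by rewrite ltr_wpDl ?divr_ge0 // ltW.
have mgfG : log_mgf G <= del.
  rewrite /log_mgf (eq_bigr (fun x => nu x + pi x * del)) => [|x _].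
    rewrite big_split /= nu1 -mulr_suml pi1 mul1r.
    by rewrite le_ln1Dx // (lt_trans _ del0).
  by rewrite lnK ?posrE // mulrDr mulrC divfK ?gt_eqF.
have entG : rel_entropy nu pi <= \sum_x nu x * G x.
  apply: ler_sum => x _.
  have [->|nuN] := eqVneq (nu x) 0; first by rewrite !mul0r.
  have nup : 0 < nu x by rewrite lt_def nuN nu0.
  by rewrite ler_wpM2l // ler_ln ?posrE ?divr_gt0 // lerDl ltW.
apply: le_trans entG _; rewrite law_step_dual.
have := gibbs_variational (tilt G) mu_law.
rewrite -(ler_pM2l lam_gt0) mulr_sumr mulrDr.
under eq_bigr do rewrite mulrCA mulVKf ?gt_eqF //.
by have := deficit_ge0 G; rewrite /deficit; lra.
Qed.

End Rate.

Theorem entropy_contraction mu : is_law mu ->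
  rel_entropy (law_step mu P) pi <= (1 - kappa) * rel_entropy mu pi.
Proof.
move=> mu_law; apply/ler_addgt0Pr => eps eps0.
have D0 : 0 < `|rel_entropy mu pi| + 1 by rewrite ltr_wpDl.
(* Chosen so that [del] times the entropy is at most [eps], whatever the sign or vanishing of the
   entropy. *)
pose del := eps / (`|rel_entropy mu pi| + 1).
have del0 : 0 < del by rewrite divr_gt0.
have := @entropy_step_le (1 - kappa + del) _ mu mu_law.
rewrite ltrDl => /(_ del0) /le_trans; apply.
rewrite mulrDl lerD2l.
apply: (@le_trans _ _ (del * (`|rel_entropy mu pi| + 1))).
  by rewrite ler_pM2l // (le_trans (ler_norm _)) // lerDl.
by rewrite divfK ?gt_eqF.
Qed.

End EntropyContraction.

(** * Single-site updates of configurations *)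

Section SingleSiteUpdates.
Context {S : finType} {n : nat}.
Implicit Types (x y : {ffun 'I_n -> S}) (i j : 'I_n) (s t : S).

Lemma upd_same x i : upd x i (x i) = x.
Proof. by apply/ffunP => j; rewrite ffunE; case: eqP => // ->. Qed.

Lemma upd_at x i s : upd x i s i = s.
Proof. by rewrite ffunE eqxx. Qed.

Lemma upd_upd x i s t : upd (upd x i s) i t = upd x i t.
Proof. by apply/ffunP => j; rewrite !ffunE; case: eqP. Qed.

Lemma differ_atP i x y :
  reflect (y = upd x i (y i) /\ y i != x i) (differ_at i x y).
Proof.
apply: (iffP eqP) => [/setP D|[yE xyi]].
  split; last by have := D i; rewrite !inE eqxx eq_sym.
  apply/ffunP => j; rewrite ffunE; case: eqP => [->//|/eqP ji].
  by have := D j; rewrite !inE (negPf ji) => /negbFE/eqP.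
apply/setP => j; rewrite !inE yE ffunE.
by have [->|] := eqVneq j i; rewrite ?eqxx // eq_sym.
Qed.

Lemma differ_at_sym i x y : differ_at i x y = differ_at i y x.
Proof.
rewrite /differ_at; congr (_ == _); apply/setP => j.
by rewrite !inE eq_sym.
Qed.

Lemma differ_at_upd i x y s : differ_at i x y -> upd y i s = upd x i s.
Proof. by case/differ_atP => -> _; rewrite upd_upd. Qed.

Lemma differ_at_off i x y j : differ_at i x y -> j != i -> y j = x j.
Proof. by case/differ_atP => -> _ /negPf ji; rewrite ffunE ji. Qed.

Lemma differ_onceP x y : reflect (exists i, differ_at i x y) (differ_once x y).
Proof.
apply: (iffP cards1P) => -[i D]; exists i; first exact/eqP.
exact/eqP.
Qed.

Lemma differ_at_once i x y : differ_at i x y -> differ_once x y.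
Proof. by move=> xy; apply/differ_onceP; exists i. Qed.

Lemma differ_once_upd x j s : s != x j -> differ_once x (upd x j s).
Proof.
move=> sx; apply: (@differ_at_once j); apply/differ_atP.
by rewrite upd_at.
Qed.

Lemma differ_once_sym x y : differ_once x y = differ_once y x.
Proof.
by apply/differ_onceP/differ_onceP => -[i]; exists i; rewrite differ_at_sym.
Qed.

Lemma differ_at_upd2 i x y j s :
  differ_at i x y -> j != i -> differ_at i (upd x j s) (upd y j s).
Proof.
move=> xy ji; have [yE xyi] := differ_atP _ _ _ xy.
have ij : (i == j) = false by rewrite eq_sym (negPf ji).
apply/differ_atP; rewrite !ffunE ij; split=> //.
apply/ffunP => k; rewrite !ffunE.
have [->|kj] := eqVneq k j; first by rewrite (negPf ji).
by rewrite {1}yE ffunE.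
Qed.

End SingleSiteUpdates.

(** * The Glauber kernel and an explicit coupling of its neighbouring rows *)

Section GlauberCoupling.
Context {R : realType} {S : finType} {n : nat}.
Variable pi : {ffun 'I_n -> S} -> R.
Hypothesis n_gt0 : (0 < n)%N.
Hypothesis pi_ge0 : forall x, 0 <= pi x.
Implicit Types (i j : 'I_n) (s : S) (x y z : {ffun 'I_n -> S}).

Let adj (x y : supp_space pi) := differ_once x y.
Let P := @glauber R S n pi.

Lemma local_mass_gt0 i x : 0 < pi x -> 0 < \sum_s pi (upd x i s).
Proof.
move=> x_gt0; rewrite (bigD1 (x i)) //= upd_same ltr_pwDl //.
exact: sumr_ge0.
Qed.

Lemma cond_law_ge0 i s x : 0 <= cond_law pi i s x.
Proof. by rewrite divr_ge0 ?sumr_ge0. Qed.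

Lemma cond_law_sum i x : 0 < pi x -> \sum_s cond_law pi i s x = 1.
Proof.
by move=> x_gt0; rewrite -mulr_suml mulfV // gt_eqF ?local_mass_gt0.
Qed.

Lemma cond_law_supp i s x : cond_law pi i s x != 0 -> 0 < pi (upd x i s).
Proof.
apply: contraNT; rewrite -leNgt => pi_le0; rewrite /cond_law.
have -> : pi (upd x i s) = 0 by apply/le_anti; rewrite pi_le0 pi_ge0.
by rewrite mul0r.
Qed.

Lemma cond_law_gt0 i s x :
  0 < pi x -> 0 < pi (upd x i s) -> 0 < cond_law pi i s x.
Proof. by move=> x0 xs0; rewrite divr_gt0 ?local_mass_gt0. Qed.

(** The conditional law at [i] ignores coordinate [i], so neighbours differing there can resample it
    identically. *)
Lemma cond_law_differ_at i s x y :
  differ_at i x y -> cond_law pi i s y = cond_law pi i s x.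
Proof.
move=> xy; rewrite /cond_law (differ_at_upd _ xy); congr (_ / _).
by apply: eq_bigr => t _; rewrite (differ_at_upd _ xy).
Qed.

Lemma supp_gt0 (x : supp_space pi) : 0 < pi x.
Proof. by case: x. Qed.

(** The guard ensures that restricting the sum to the support loses no mass: if [z] lies outside,
    [w] is 0. *)
Lemma sum_supp_point (w : R) z : (w != 0 -> 0 < pi z) ->
  \sum_(v : supp_space pi) w * ((v : {ffun _ -> _}) == z)%:R = w.
Proof.
have [->|_ /(_ isT) z_gt0] := eqVneq w 0.
  by rewrite big1 // => v _; rewrite mul0r.
rewrite (bigD1 (SuppSpace z_gt0)) //= eqxx mulr1 big1 ?addr0 // => v vz.
rewrite (_ : _ == z = false) ?mulr0 //; apply/negbTE.
by apply: contra vz => vz; apply/eqP/val_inj/eqP.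
Qed.

Lemma glauber_law (x : supp_space pi) : is_law (P x).
Proof.
split=> [y|].
  rewrite mulr_ge0 ?invr_ge0 ?ler0n // sumr_ge0 // => i _.
  by rewrite sumr_ge0 // => s _; rewrite mulr_ge0 ?cond_law_ge0 ?ler0n.
rewrite -mulr_sumr exchange_big /=.
rewrite (eq_bigr (fun=> 1)) => [|i _].
  by rewrite sumr_const card_ord mulVf // pnatr_eq0 -lt0n.
rewrite exchange_big /= -[RHS](cond_law_sum i (supp_gt0 x)).
by apply: eq_bigr => s _; apply: sum_supp_point; apply: cond_law_supp.
Qed.

(** Detailed balance holds site by site: moves in both directions along [i] share the same
    normalizing sum. *)
Lemma glauber_reversible (x y : supp_space pi) :
  pi x * P x y = pi y * P y x.
Proof.
have siteE (u v : {ffun 'I_n -> S}) i :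
    \sum_s cond_law pi i s u * (v == upd u i s)%:R
    = cond_law pi i (v i) u * (v == upd u i (v i))%:R.
  rewrite (bigD1 (v i)) //= big1 ?addr0 // => s sv.
  case: eqP => [vE|_]; last by rewrite mulr0.
  by move: sv; rewrite vE upd_at eqxx.
rewrite /P /glauber mulrCA [RHS]mulrCA; congr (_ * _).
rewrite !mulr_sumr; apply: eq_bigr => i _; rewrite !siteE.
have [yE|yN] := eqVneq (y : {ffun _ -> _}) (upd x i (y i)).
  have xE : upd y i (x i) = x by rewrite yE upd_upd upd_same.
  rewrite xE eqxx /cond_law -yE xE !mulr1 mulrCA; congr (_ * (_ / _)).
  by apply: eq_bigr => s _; rewrite yE upd_upd.
rewrite mulr0 mulr0; case: eqP => [xE|_]; last by rewrite !mulr0.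
by move: yN; rewrite xE upd_upd upd_same eqxx.
Qed.

Lemma glauber_upd_gt0 (x y : supp_space pi) i :
  y = upd x i (y i) :> {ffun _ -> _} -> 0 < P x y.
Proof.
move=> yE; rewrite mulr_gt0 ?invr_gt0 ?ltr0n //.
have term_ge0 j s :
    0 <= cond_law pi j s x * ((y : {ffun _ -> _}) == upd x j s)%:R.
  by rewrite mulr_ge0 ?cond_law_ge0 ?ler0n.
rewrite (bigD1 i) //= ltr_pwDl ?sumr_ge0 // => [|j _]; last exact: sumr_ge0.
rewrite (bigD1 (y i)) //= -yE eqxx mulr1 ltr_pwDl ?sumr_ge0 //.
by rewrite cond_law_gt0 -?yE ?supp_gt0.
Qed.

Lemma glauber_gt0 (x y : supp_space pi) : (0 < P x y) <-> (x = y \/ adj x y).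
Proof.
split=> [|[<-|/differ_onceP [i /differ_atP [yE _]]]].
- rewrite pmulr_rgt0 ?invr_gt0 ?ltr0n // => /psumr_gt0 [i /psumr_gt0 [s]].
  case: eqP => [yE _|_]; last by rewrite mulr0 ltxx.
  have [sx|sx] := eqVneq s (x i).
    by left; apply: val_inj; rewrite /= yE sx upd_same.
  by right; rewrite /adj yE differ_once_upd.
(* Resampling a site to its current value leaves the chain in place; [n_gt0] supplies a site. *)
- by apply: (@glauber_upd_gt0 _ _ (Ordinal n_gt0)); rewrite upd_same.
- exact: glauber_upd_gt0 yE.
Qed.

Definition excess i x y : R :=
  \sum_(j < n | j != i) \sum_(s : S | s != x j)
     Num.max (cond_law pi j s y - cond_law pi j s x) 0.

(** The mass left for both chains to refresh site [i] to [s], after reserving what pays for the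
    unmatched moves at other sites. *)
Definition site_weight i x y s : R :=
  cond_law pi i s x
  - excess i x y * (s == y i)%:R - excess i y x * (s == x i)%:R.

Definition at_pair z z' u v : R := (u == z)%:R * (v == z')%:R.

(* For j != i both chains resample site j with the same s as often as possible.
   When only the chain from y moves to upd y j s, the chain from x jumps to y,
   and symmetrically; the weak dependency condition says that the moves
   x -> y and y -> x have enough mass to pay for this. *)
Definition resample_mass x y j s u v : R :=
  Num.min (cond_law pi j s x) (cond_law pi j s y)
    * at_pair (upd x j s) (upd y j s) u v
  + Num.max (cond_law pi j s y - cond_law pi j s x) 0
    * at_pair y (upd y j s) u v
  + Num.max (cond_law pi j s x - cond_law pi j s y) 0
    * at_pair (upd x j s) x u v.

(** The last term keeps both chains in place. Its summand [excess i y x] returns to the first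
    marginal, at [x], the mass that [site_weight] removed there. *)
Definition pair_coupling i x y u v : R := n%:R^-1 *
  (\sum_(j < n | j != i) \sum_(s | s != x j) resample_mass x y j s u v
   + \sum_s site_weight i x y s * at_pair (upd x i s) (upd x i s) u v
   + (excess i y x + \sum_(j < n | j != i) cond_law pi j (x j) x)
     * at_pair x y u v).

Lemma excess_ge0 i x y : 0 <= excess i x y.
Proof.
by apply: sumr_ge0 => j _; apply: sumr_ge0 => s _; rewrite le_max lexx orbT.
Qed.

(** At each site both conditional laws have mass 1, so the two positive parts differ by the
    difference of the holding probabilities. *)
Lemma excess_balance i (x y : supp_space pi) : differ_at i x y ->
  excess i y x + \sum_(j < n | j != i) cond_law pi j (x j) x
  = excess i x y + \sum_(j < n | j != i) cond_law pi j (y j) y.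
Proof.
move=> xy; rewrite /excess -!big_split /=; apply: eq_bigr => j ji.
rewrite (differ_at_off xy ji).
have := cond_law_sum j (supp_gt0 x); rewrite (bigD1 (x j)) //= => x1.
have := cond_law_sum j (supp_gt0 y); rewrite (bigD1 (x j)) //= => y1.
have : \sum_(s | s != x j) Num.max (cond_law pi j s x - cond_law pi j s y) 0
    - \sum_(s | s != x j) Num.max (cond_law pi j s y - cond_law pi j s x) 0
    = \sum_(s | s != x j) cond_law pi j s x
      - \sum_(s | s != x j) cond_law pi j s y.
  rewrite -!sumrB; apply: eq_bigr => s _.
  by case: leP => ?; case: leP => ?; lra.
lra.
Qed.

Lemma slackE i x y : differ_at i x y ->
  dependency_slack pi i x y = 1 - excess i x y - excess i y x.
Proof.
move=> xy; rewrite /dependency_slack -addrA -opprD /excess -big_split /=.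
congr (1 - _); apply: eq_bigr => j ji.
rewrite (differ_at_off xy ji) -big_split /=; apply: eq_bigr => s _.
by case: ger0P => ?; case: leP => ?; lra.
Qed.

(** Reduces the second marginal to the first; [excess_balance] handles the holding term, written
    asymmetrically. *)
Lemma pair_coupling_sym i (x y : supp_space pi) u v : differ_at i x y ->
  pair_coupling i x y u v = pair_coupling i y x v u.
Proof.
move=> xy; rewrite /pair_coupling (excess_balance xy); congr (_ * (_ + _ + _)).
- apply: eq_bigr => j ji; rewrite (differ_at_off xy ji); apply: eq_bigr => s _.
  by rewrite /resample_mass /at_pair minC; ring.
- apply: eq_bigr => s _; rewrite /site_weight /at_pair.
  by rewrite (cond_law_differ_at _ xy) (differ_at_upd _ xy); ring.
- by rewrite /at_pair; ring.
Qed.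

Lemma sum_at_pair_r w z z' u : (w != 0 -> 0 < pi z') ->
  \sum_(v : supp_space pi) w * at_pair z z' u v = w * (u == z)%:R.
Proof.
move=> wz'; under eq_bigr do rewrite /at_pair mulrA.
by rewrite sum_supp_point // mulf_eq0 negb_or => /andP [/wz'].
Qed.

Hypothesis pi_weak : weak_dependency pi.

(** Since [x i] and [y i] differ, each [s] undergoes at most one subtraction, covered by weak
    dependency for [(x, y)] or [(y, x)]. *)
Lemma site_weight_ge0 i (x y : supp_space pi) s :
  differ_at i x y -> 0 <= site_weight i x y s.
Proof.
move=> xy; have yx := xy; rewrite differ_at_sym in yx.
have wxy := pi_weak xy; have wyx := pi_weak yx.
have [_ /negPf yxi] := differ_atP _ _ _ xy.
rewrite (cond_law_differ_at _ xy) in wyx.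
rewrite /site_weight; have [->|sy] := eqVneq s (y i).
  by rewrite yxi mulr1 mulr0 subr0 subr_ge0.
rewrite mulr0 subr0; have [->|sx] := eqVneq s (x i).
  by rewrite mulr1 subr_ge0.
by rewrite mulr0 subr0 cond_law_ge0.
Qed.

Lemma site_weight_supp i (x y : supp_space pi) s : differ_at i x y ->
  site_weight i x y s != 0 -> 0 < pi (upd x i s).
Proof.
move=> xy w0.
have : 0 < site_weight i x y s by rewrite lt_def w0 site_weight_ge0.
rewrite /site_weight => w_gt0; apply: cond_law_supp; apply/eqP => c0.
move: w_gt0; rewrite c0 ltNge => /negP; apply.
rewrite sub0r -opprD oppr_le0 addr_ge0 // mulr_ge0 ?excess_ge0 //; exact: ler0n.
Qed.

Lemma sum_site_weight i (x y : supp_space pi) (f : S -> R) :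
  \sum_s site_weight i x y s * f s
  = \sum_s cond_law pi i s x * f s
    - excess i x y * f (y i) - excess i y x * f (x i).
Proof.
have pt (c : R) (t : S) : c * f t = \sum_s c * (s == t)%:R * f s.
  rewrite (bigD1 t) //= eqxx mulr1 big1 ?addr0 // => s /negPf ->.
  by rewrite mulr0 mul0r.
rewrite !pt -!sumrB; apply: eq_bigr => s _.
by rewrite /site_weight !mulrBl.
Qed.

Lemma at_pair_ge0 z z' u v : 0 <= at_pair z z' u v.
Proof. by rewrite mulr_ge0 ?ler0n. Qed.

Lemma resample_sum_ge0 i x y u v :
  0 <= \sum_(j < n | j != i) \sum_(s | s != x j) resample_mass x y j s u v.
Proof.
apply: sumr_ge0 => j _; apply: sumr_ge0 => s _.
rewrite !addr_ge0 // mulr_ge0 ?at_pair_ge0 ?le_max ?lexx ?orbT //.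
by rewrite le_min !cond_law_ge0.
Qed.

Lemma jump_mass_ge0 i x y u v :
  0 <= (excess i y x + \sum_(j < n | j != i) cond_law pi j (x j) x)
       * at_pair x y u v.
Proof.
rewrite mulr_ge0 ?at_pair_ge0 // addr_ge0 ?excess_ge0 //.
by apply: sumr_ge0 => j _; apply: cond_law_ge0.
Qed.

Lemma pair_coupling_ge0 i (x y : supp_space pi) u v :
  differ_at i x y -> 0 <= pair_coupling i x y u v.
Proof.
move=> xy; rewrite mulr_ge0 ?invr_ge0 ?ler0n //.
rewrite !addr_ge0 ?jump_mass_ge0 ?resample_sum_ge0 //.
by apply: sumr_ge0 => s _; rewrite mulr_ge0 ?at_pair_ge0 ?site_weight_ge0.
Qed.

Lemma pair_coupling_marginal i (x y u : supp_space pi) : differ_at i x y ->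
  \sum_(v : supp_space pi) pair_coupling i x y u v = P x u.
Proof.
move=> xy; have [yE yxi] := differ_atP _ _ _ xy.
rewrite -mulr_sumr /P /glauber; congr (_ * _).
rewrite !big_split /= (sum_at_pair_r _ _ (fun=> supp_gt0 y)).
rewrite [X in _ + X + _]exchange_big /=.
under [X in _ + X + _]eq_bigr => s _.
  rewrite (sum_at_pair_r _ _ (@site_weight_supp _ _ _ s xy)); over.
rewrite (sum_site_weight _ _ _
  (fun s => ((u : {ffun _ -> _}) == upd x i s)%:R)).
rewrite -yE upd_same [in RHS](bigD1 i) //=.
rewrite [X in X + _ + _]exchange_big /=.
(* The minimum and the positive part in favour of [x] add up to [cond_law pi j s x]; moves of the
   second chain alone send the first to [y]. *)
have siteE j : j != i ->
    \sum_(v : supp_space pi) \sum_(s | s != x j) resample_mass x y j s u v =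
    (\sum_s cond_law pi j s x * ((u : {ffun _ -> _}) == upd x j s)%:R
     - cond_law pi j (x j) x * ((u : {ffun _ -> _}) == x)%:R)
    + (\sum_(s | s != x j) Num.max (cond_law pi j s y - cond_law pi j s x) 0)
      * ((u : {ffun _ -> _}) == y)%:R.
  move=> ji; rewrite exchange_big /= mulr_suml.
  rewrite [X in _ = X - _ + _](bigD1 (x j)) //= upd_same [_ + _ - _]addrAC.
  rewrite subrr add0r.
  rewrite -big_split /=; apply: eq_bigr => s _.
  rewrite /resample_mass !big_split /=.
  rewrite (sum_at_pair_r _ _ (fun=> supp_gt0 x)) !sum_at_pair_r.
  - rewrite addrAC; congr (_ + _); rewrite -mulrDl; congr (_ * _).
    by case: leP => ?; case: leP => ?; lra.
  - move=> m0; apply: cond_law_supp; apply: contraNneq m0 => ->.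
    by rewrite sub0r; apply/eqP/max_r; rewrite oppr_le0 cond_law_ge0.
  - move=> m0; apply: cond_law_supp; apply: contraNneq m0 => ->.
    by apply/eqP/min_r/cond_law_ge0.
(* The excesses now cancel against those subtracted in [site_weight]: [excess i x y] at [y],
   [excess i y x] at [x]. *)
rewrite (eq_bigr _ siteE) big_split /= sumrB -!mulr_suml -/(excess i x y).
by ring.
Qed.

Lemma pair_coupling_is_coupling i (x y : supp_space pi) : differ_at i x y ->
  is_coupling (P x) (P y)
    (fun u v : supp_space pi => pair_coupling i x y u v).
Proof.
move=> xy; have yx := xy; rewrite differ_at_sym in yx; split.
- by move=> u v; apply: pair_coupling_ge0.
- have [_ <-] := glauber_law x; apply: eq_bigr => u _.
  exact: pair_coupling_marginal.
- by move=> u; apply: pair_coupling_marginal.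
- move=> v; rewrite -(pair_coupling_marginal v yx); apply: eq_bigr => u _.
  exact: pair_coupling_sym.
Qed.

Lemma pair_coupling_close i (x y u v : supp_space pi) : differ_at i x y ->
  0 < pair_coupling i x y u v -> u = v \/ adj u v.
Proof.
move=> xy C_gt0; apply: contrapT => far.
(* Every atom of the coupling sits on an equal or adjacent pair, hence misses a far pair [u],
   [v]. *)
have at0 z z' : z = z' \/ differ_once z z' -> at_pair z z' u v = 0.
  rewrite /at_pair => zz'; case: eqP => [uz|_]; last by rewrite mul0r.
  case: eqP => [vz|_]; last by rewrite mulr0.
  case: far; case: zz' => [zz'|]; last by rewrite -uz -vz; right.
  by left; apply: val_inj; rewrite /= uz vz.
move: C_gt0; rewrite /pair_coupling.
rewrite (at0 x y (or_intror (differ_at_once xy))) mulr0 addr0.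
rewrite [X in _ + X]big1 ?addr0 => [|s _]; last by rewrite at0 ?mulr0 //; left.
rewrite big1 ?mulr0 ?ltxx // => j ji; rewrite big1 // => s sx.
rewrite /resample_mass !at0 ?mulr0 ?addr0 //; right.
- by rewrite differ_once_sym differ_once_upd.
- by rewrite differ_once_upd // (differ_at_off xy ji).
- exact: differ_at_once (differ_at_upd2 _ xy ji).
Qed.

(** Joint refreshes of site [i] alone have diagonal mass equal to the total [site_weight], which is
    the slack; the other terms are nonnegative. *)
Lemma pair_coupling_diag i (x y : supp_space pi) : differ_at i x y ->
  n%:R^-1 * dependency_slack pi i x y
  <= \sum_(u : supp_space pi) pair_coupling i x y u u.
Proof.
move=> xy; rewrite -mulr_sumr ler_wpM2l ?invr_ge0 ?ler0n //.
have -> : dependency_slack pi i x y = \sum_(u : supp_space pi)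
    \sum_s site_weight i x y s * at_pair (upd x i s) (upd x i s) u u.
  rewrite exchange_big /= slackE // -(cond_law_sum i (supp_gt0 x)).
  have := sum_site_weight i x y (fun=> 1); rewrite !mulr1.
  under [X in _ = X - _ - _]eq_bigr do rewrite mulr1.
  move=> <-; apply: eq_bigr => s _; rewrite mulr1.
  rewrite -[LHS](sum_supp_point (@site_weight_supp _ _ _ s xy)).
  by apply: eq_bigr => v _; rewrite /at_pair; case: eqP; rewrite ?mulr1 ?mulr0.
apply: ler_sum => u _.
by rewrite -addrA addrCA lerDl addr_ge0 ?resample_sum_ge0 ?jump_mass_ge0.
Qed.

Lemma slack_ge0 i (x y : supp_space pi) :
  differ_at i x y -> 0 <= dependency_slack pi i x y.
Proof.
move=> xy; rewrite slackE // -(cond_law_sum i (supp_gt0 x)).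
have := sum_site_weight i x y (fun=> 1); rewrite !mulr1.
under [X in _ = X - _ - _]eq_bigr do rewrite mulr1.
by move=> <-; apply: sumr_ge0 => s _; rewrite mulr1 site_weight_ge0.
Qed.

Lemma slack_min_ge0 : (0 <= \big[mine/+oo%E]_(i < n)
   \big[mine/+oo%E]_(x : supp_space pi)
   \big[mine/+oo%E]_(y : supp_space pi | differ_at i x y)
     (dependency_slack pi i x y)%:E)%E.
Proof.
apply: le_bigmin => [|i _]; first exact: leey.
apply: le_bigmin => [|x _]; first exact: leey.
apply: le_bigmin => [|y xy]; first exact: leey.
by rewrite lee_fin slack_ge0.
Qed.

Lemma glauber_kappa_ge0 : 0 <= glauber_kappa pi.
Proof. by rewrite mulr_ge0 ?invr_ge0 ?ler0n // fine_ge0 ?slack_min_ge0. Qed.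

Lemma glauber_kappa_le i (x y : supp_space pi) : differ_at i x y ->
  glauber_kappa pi <= n%:R^-1 * dependency_slack pi i x y.
Proof.
move=> xy; rewrite ler_wpM2l ?invr_ge0 ?ler0n //.
have m_ge0 := slack_min_ge0; set m := \big[mine/_]_(i < n) _ in m_ge0 *.
have : (m <= (dependency_slack pi i x y)%:E)%E.
  apply: le_trans (bigmin_le _ i _) _; apply: le_trans (bigmin_le _ x _) _.
  exact: bigmin_le_cond.
(* Lying between 0 and a real number, [m] is finite, so [fine] does not fall back on a default. *)
by case: m m_ge0.
Qed.

Lemma adj_coupling (x y : supp_space pi) : adj x y ->
  exists2 C, is_coupling (P x) (P y) C &
    (forall u v, 0 < C u v -> u = v \/ adj u v) /\
    glauber_kappa pi <= \sum_u C u u.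
Proof.
case/differ_onceP => i xy.
exists (fun u v : supp_space pi => pair_coupling i x y u v).
  exact: pair_coupling_is_coupling.
split=> [u v|]; first exact: pair_coupling_close.
exact: le_trans (glauber_kappa_le xy) (pair_coupling_diag xy).
Qed.

(** Recasts the neighbour coupling for [kernel_pow_coupling]: positive entries of [P] are exactly
    the equal or adjacent pairs. *)
Lemma glauber_row_coupling (x y : supp_space pi) : 0 < P x y ->
  exists2 C, is_coupling (P x) (P y) C & forall u v, 0 < C u v -> 0 < P u v.
Proof.
move=> /glauber_gt0 [<-|/adj_coupling [C Cc [Ce _]]].
  exists (fun u v => P x u * (u == v)%:R).
    exact/coupling_diag/glauber_law.
  move=> u v; have [<- _|_] := eqVneq u v; last by rewrite mulr0 ltxx.
  by apply/glauber_gt0; left.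
by exists C => // u v /Ce uv; apply/glauber_gt0.
Qed.

End GlauberCoupling.

Theorem corollary5 (R : realType) (S : finType) (n : nat) (hn : (0 < n)%N)
    (pi : {ffun 'I_n -> S} -> R) (hpi : is_law pi)
    (hcard : (1 < #|{: supp_space pi}|)%N)
    (hconn : single_site_connected pi)
    (hweak : weak_dependency pi) :
  let P := @glauber R S n pi in
  let kappa := glauber_kappa pi in
  nonneg_sectional_curvature (@pi_on_supp R S n pi) P
    (fun x y => (comb_dist P x y)%:R) /\
  (0 <= kappa /\
   forall mu : supp_space pi -> R, is_law mu ->
     rel_entropy (law_step mu P) (@pi_on_supp R S n pi)
       <= (1 - kappa) * rel_entropy mu (@pi_on_supp R S n pi)).
Proof.
move=> P kappa; have [pi_ge0 pi_sum] := hpi.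
have P_law := glauber_law hn pi_ge0.
have P_rev : forall x y, pi_on_supp x * P x y = pi_on_supp y * P y x :=
  @glauber_reversible R S n pi.
split; last split.
- exists P => [|x y]; first exact: reversible_adjoint.
  (* Connectedness rules out the default value of [comb_dist]. *)
  have xy : 0 < kernel_pow P (comb_dist P x y) x y.
    apply/comb_dist_gt0/(kernel_pow_connect _ _ (hconn x y)) => u v.
      by have [] := P_law u.
    by move=> uv; apply/(glauber_gt0 hn pi_ge0); right.
  have row_cpl := glauber_row_coupling hn pi_ge0 hweak.
  have [C Cc Cp] := kernel_pow_coupling P_law row_cpl xy.
  by exists C => // u v /Cp uv; rewrite ler_nat comb_dist_le.
- exact: glauber_kappa_ge0.
(* Two distinct points joined by a path yield an edge, and [kappa] is at most the diagonal mass of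
   its coupling. *)
have kappa_le1 : kappa <= 1.
  have /card_gt1P [x [y [_ _ xy]]] := hcard.
  have /connectP [[|z p] /= xp yE] := hconn x y.
    by rewrite yE eqxx in xy.
  have /andP [xz _] := xp.
  have [C [C_ge0 C_sum _ _] [_ kC]] := adj_coupling hn pi_ge0 hweak xz.
  apply: le_trans kC _; rewrite -C_sum; apply: ler_sum => u _.
  by rewrite (bigD1 u) //= lerDl sumr_ge0.
have pi_law : is_law (@pi_on_supp R S n pi).
  split=> [x|]; first exact: pi_ge0.
  (* Configurations outside the support carry no mass; the others are reindexed by the subtype. *)
  rewrite -pi_sum (bigID (fun x => 0 < pi x)) /= [X in _ + X]big1 ?addr0.
    rewrite (reindex_omap (@supp_val R S n pi) insub) /=.
      by apply: eq_bigl => x; rewrite valK eqxx andbT supp_gt0.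
    by move=> x x_gt0; rewrite insubT.
  by move=> x; rewrite -leNgt => x_le0; apply/le_anti; rewrite x_le0 pi_ge0.
exact: (entropy_contraction (@supp_gt0 R S n pi) pi_law P_law P_rev hconn
  kappa_le1 (adj_coupling hn pi_ge0 hweak)).
Qed.
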